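(* Let $a$ and $n$ be positive integers and let $S=\{x_1,\dots,x_n\}$ be a factor closed set of $n$ distinct positive integers, indexed so that $x_1=1$. Let $B_a=(b_{ij})_{1\le i,j\le n}$ be the matrix with $b_{ij}=\mu\left(\frac{x_j}{x_i}\right)\left(\frac{x_j}{x_i}\right)^a$ if $x_i\mid x_j$ and $b_{ij}=0$ otherwise. Then $$B_a^T\,\big([x_i,x_j]^a\big)\,B_a=\operatorname{diag}\Big(1,\ \prod_{p\mid x_2}\big(p^{a\nu_p(x_2)}-p^{a(\nu_p(x_2)+1)}\big),\ \dots,\ \prod_{p\mid x_n}\big(p^{a\nu_p(x_n)}-p^{a(\nu_p(x_n)+1)}\big)\Big),$$ where the products run over the primes $p$ dividing the indicated integer.
   Context: $[x,y]$ denotes the least common multiple of $x$ and $y$, and $([x_i,x_j]^a)$ denotes the $n\times n$ matrix whose $(i,j)$-entry is $[x_i,x_j]^a$. A set $S$ of positive integers is factor closed if every positive divisor of every element of $S$ lies in $S$. $\mu$ is the Möbius function and $\nu_p(x)$ is the $p$-adic valuation of $x$. *)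

(* Defs.v *)
From mathcomp Require Import all_boot all_order all_algebra.

Set Implicit Arguments.
Unset Strict Implicit.
Unset Printing Implicit Defensive.

Import GRing.Theory.
Local Open Scope ring_scope.

Definition factor_closed (S : pred nat) : Prop :=
  forall m d : nat, m \in S -> (0 < d)%N -> (d %| m)%N -> d \in S.

Definition squarefree (m : nat) : bool :=
  (0 < m)%N && all (fun p => ~~ (p ^ 2 %| m)%N) (primes m).

Definition moebius (m : nat) : int :=
  if squarefree m then (-1) ^+ size (primes m) else 0.

Definition lcm_power_matrix (a n : nat) (x : 'I_n -> nat) : 'M[int]_n :=
  \matrix_(i, j) (lcmn (x i) (x j))%:Z ^+ a.

Definition B_matrix (a n : nat) (x : 'I_n -> nat) : 'M[int]_n :=
  \matrix_(i, j)
    if (x i %| x j)%N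
    then moebius (x j %/ x i)%N * ((x j %/ x i)%N)%:Z ^+ a
    else 0.

(* [logn p m] is the p-adic valuation of m. *)
Definition diag_entry (a m : nat) : int :=
  \prod_(p <- primes m)
    (p%:Z ^+ (a * logn p m)%N - p%:Z ^+ (a * (logn p m).+1)%N).

(* Main.v *)
(** Over the lattice of divisors, [B] inverts the matrix [C] with entries
    [(x_j / x_i) ^ a] for [x_i | x_j], which is Moebius inversion. With
    [rho c] the product of [1 - p ^ a] over the primes [p | c], the diagonal
    entry at [c] is [c ^ a * rho c], and the identity
    [\sum_(c | g) (g / c) ^ a * rho c = 1], applied at [g = gcd (x_i, x_j)],
    says that the lcm matrix is [C^T D C]. Hence [B^T (C^T D C) B = D].
    Both divisor sums follow from one recursion: the divisors of
    [p ^ k.+1 * m], for [p] prime to [m], are those of [p ^ k * m] and the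
    [p ^ k.+1 * e] with [e | m]. *)
Require Import Defs.
From mathcomp Require Import all_boot all_order all_algebra.
From mathcomp Require Import ring.

Import GRing.Theory.
Local Open Scope ring_scope.

(** Strong induction on [n], removing one copy of its least prime factor [p]. Both [P m] and
    [P (p ^ k * m)] are supplied because a sum over the divisors of [p ^ k.+1 * m] splits into sums
    over the divisors of these two numbers. *)
Lemma primepow_mul_ind (P : nat -> Prop) :
  P 1%N ->
  (forall p k m, prime p -> ~~ (p %| m)%N -> (0 < m)%N ->
     P m -> P (p ^ k * m)%N -> P (p ^ k.+1 * m)%N) ->
  forall n, (0 < n)%N -> P n.
Proof.
move=> P1 PS n; elim/ltn_ind: n => n IH n_gt0.
have [n_gt1|] := ltnP 1 n; last by case: n n_gt0 {IH} => [|[|n]].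
have pp := pdiv_prime n_gt1; set p := pdiv n in pp.
have [m cop_pm def_n] := pfactor_coprime pp n_gt0.
have m_gt0 : (0 < m)%N by move: n_gt0; rewrite def_n muln_gt0 => /andP[].
have : (0 < logn p n)%N by rewrite logn_gt0 mem_primes pp n_gt0 pdiv_dvd.
case: (logn p n) def_n => // k def_n _.
have p_gt1 := prime_gt1 pp; have p_gt0 := prime_gt0 pp.
rewrite mulnC in def_n.
have lt_n : (p ^ k * m < n)%N.
  by rewrite def_n ltn_pmul2r // ltn_exp2l.
rewrite def_n; apply: PS => //; first by rewrite -prime_coprime.
  apply: IH => //; apply: leq_ltn_trans lt_n.
  by rewrite leq_pmull // expn_gt0 p_gt0.
by apply: IH => //; rewrite muln_gt0 expn_gt0 p_gt0.
Qed.

Lemma divisors_primepow_mul p k m :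
  prime p -> ~~ (p %| m)%N -> (0 < m)%N ->
  perm_eq (divisors (p ^ k.+1 * m))
    (divisors (p ^ k * m) ++ [seq (p ^ k.+1 * e)%N | e <- divisors m]).
Proof.
move=> pp pNm m_gt0; have p_gt0 := prime_gt0 pp.
have pX_gt0 j : (0 < p ^ j)%N by rewrite expn_gt0 p_gt0.
apply: uniq_perm; first exact: divisors_uniq.
  rewrite cat_uniq divisors_uniq map_inj_in_uniq ?divisors_uniq ?andbT /=;
    last by move=> e f _ _ /eqP; rewrite eqn_pmul2l // => /eqP.
  (* The two lists are disjoint: [p ^ k.+1 * e] dividing [p ^ k * m] would force [p] to divide
     [m]. *)
  apply/hasPn => _ /mapP[e _ ->]; rewrite -dvdn_divisors ?muln_gt0 ?pX_gt0 //.
  apply: contra pNm => /(dvdn_trans (dvdn_mulr e (dvdnn _))).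
  by rewrite expnSr dvdn_pmul2l.
move=> d; rewrite mem_cat -!dvdn_divisors ?muln_gt0 ?pX_gt0 //.
apply/idP/orP => [dv|[dv|/mapP[e]]]; last 2 first.
- by apply: dvdn_trans dv _; rewrite expnS -mulnA dvdn_mull.
- by rewrite -dvdn_divisors // => e_m ->; rewrite dvdn_pmul2l.
have d_gt0 : (0 < d)%N by apply: dvdn_gt0 dv; rewrite muln_gt0 pX_gt0.
have [pkd|pkNd] := boolP (p ^ k.+1 %| d)%N.
  right; apply/mapP; exists (d %/ p ^ k.+1)%N; last by rewrite mulnC divnK.
  by rewrite -dvdn_divisors // -(@dvdn_pmul2l (p ^ k.+1)) // mulnC divnK.
(* Here [d] is [e] times a power of [p] with exponent at most [k], and [e], being prime to [p],
   divides [m]. *)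
left; have [e cop_pe def_d] := pfactor_coprime pp d_gt0.
rewrite def_d mulnC; apply: dvdn_mul.
  by apply: dvdn_exp2l; rewrite leqNgt -pfactor_dvdn.
have : (e %| p ^ k.+1 * m)%N.
  by apply: dvdn_trans dv; rewrite def_d dvdn_mulr.
by rewrite Gauss_dvdr // coprime_sym coprimeXl.
Qed.

Lemma sum_divisors_primepow_mul (f : nat -> int) p k m :
  prime p -> ~~ (p %| m)%N -> (0 < m)%N ->
  \sum_(d <- divisors (p ^ k.+1 * m)) f d =
  \sum_(d <- divisors (p ^ k * m)) f d
    + \sum_(e <- divisors m) f (p ^ k.+1 * e)%N.
Proof.
move=> pp pNm m_gt0.
by rewrite (perm_big _ (divisors_primepow_mul _ k _ pp pNm m_gt0)) big_cat big_map.
Qed.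

Lemma primes_primepow_mul p k m :
  prime p -> ~~ (p %| m)%N -> (0 < m)%N ->
  perm_eq (primes (p ^ k.+1 * m)) (p :: primes m).
Proof.
move=> pp pNm m_gt0; apply: uniq_perm; first exact: primes_uniq.
  by rewrite /= primes_uniq mem_primes (negPf pNm) !andbF.
move=> q; rewrite primesM ?expn_gt0 ?(prime_gt0 pp) // primesX // primes_prime //.
by rewrite !inE.
Qed.

Lemma moebius_prime_mul p m :
  prime p -> ~~ (p %| m)%N -> (0 < m)%N -> moebius (p * m) = - moebius m.
Proof.
move=> pp pNm m_gt0; have p_gt0 := prime_gt0 pp.
have permp : perm_eq (primes (p * m)) (p :: primes m).
  by rewrite -{1}(expn1 p); apply: primes_primepow_mul.
rewrite /moebius /squarefree muln_gt0 p_gt0 m_gt0 (perm_all _ permp).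
rewrite (perm_size permp) /= -mulnn dvdn_pmul2l // pNm /=.
(* A prime [q] dividing [m] differs from [p], so the new factor [p] does not affect divisibility by
   [q ^ 2]. *)
have -> : all (fun q => ~~ (q ^ 2 %| p * m)%N) (primes m)
          = all (fun q => ~~ (q ^ 2 %| m)%N) (primes m).
  apply: eq_in_all => q; rewrite mem_primes => /and3P[pq _ q_m].
  rewrite Gauss_dvdr // coprimeXl // prime_coprime // dvdn_prime2 //.
  by apply: contraNneq pNm => <-.
by case: ifP; rewrite ?oppr0 // exprS mulN1r.
Qed.

Lemma moebius_sq_mul p k m : prime p -> moebius (p ^ k.+2 * m) = 0.
Proof.
move=> pp; rewrite /moebius /squarefree.
case: ifP => // /andP[n_gt0 /allP /(_ p)].
have p2_n : (p ^ 2 %| p ^ k.+2 * m)%N by rewrite dvdn_mulr // dvdn_exp2l.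
rewrite mem_primes pp n_gt0 p2_n (dvdn_trans _ p2_n) ?dvdn_exp //.
by move/(_ isT).
Qed.

Lemma sum_moebius n :
  (0 < n)%N -> \sum_(d <- divisors n) moebius d = (n == 1%N)%:R.
Proof.
move: n; apply: primepow_mul_ind => [|p k m pp pNm m_gt0 _ IH].
  by rewrite (_ : divisors 1 = [:: 1%N]) // big_seq1.
have neq1 j : (p ^ j.+1 * m == 1)%N = false.
  by rewrite expnS -mulnA muln_eq1 gtn_eqF // prime_gt1.
(* For a new prime the two sums cancel term by term. Otherwise the new divisors contain [p ^ 2] and
   contribute nothing, and the old sum vanishes by induction. *)
rewrite neq1 sum_divisors_primepow_mul //; case: k IH => [|k] IH.
  rewrite expn0 mul1n expn1 -big_split big_seq big1 // => e.
  rewrite -dvdn_divisors // => e_m /=.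
  rewrite moebius_prime_mul ?subrr ?(dvdn_gt0 m_gt0) //.
  by apply: contra pNm => /dvdn_trans; apply.
rewrite IH neq1 add0r.
by rewrite big1 // => e _; apply: moebius_sq_mul.
Qed.

(** For positive [m] this is the sum of [moebius d * d ^ a] over [d | m], the Dirichlet convolution
    of the constant 1 with the inverse of [d ^ a]. *)
Definition rho (a m : nat) : int := \prod_(p <- primes m) (1 - p%:Z ^+ a).

Lemma rho_primepow_mul a p k m :
  prime p -> ~~ (p %| m)%N -> (0 < m)%N ->
  rho a (p ^ k.+1 * m) = (1 - p%:Z ^+ a) * rho a m.
Proof.
move=> pp pNm m_gt0.
by rewrite /rho (perm_big _ (primes_primepow_mul p k m pp pNm m_gt0)) big_cons.
Qed.

(** The old divisors contribute [p ^ a], since each cofactor gains one [p]; the new ones contribute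
    [1 - p ^ a], since [rho] gains that factor while the cofactors are those in [m]. *)
Lemma sum_rho a n : (0 < n)%N ->
  \sum_(d <- divisors n) (n %/ d)%N%:Z ^+ a * rho a d = 1.
Proof.
move: n; apply: primepow_mul_ind => [|p k m pp pNm m_gt0 IHm IHk].
  by rewrite (_ : divisors 1 = [:: 1%N]) // big_seq1 /rho big_nil expr1n.
have pX_gt0 j : (0 < p ^ j)%N by rewrite expn_gt0 prime_gt0.
rewrite sum_divisors_primepow_mul //.
have -> : \sum_(d <- divisors (p ^ k * m))
    (p ^ k.+1 * m %/ d)%N%:Z ^+ a * rho a d = p%:Z ^+ a.
  rewrite -[RHS]mulr1 -IHk big_distrr /= !big_seq; apply: eq_bigr => d.
  rewrite -dvdn_divisors ?muln_gt0 ?pX_gt0 // => d_n.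
  by rewrite expnS -mulnA -muln_divA // PoszM exprMn mulrA.
have -> : \sum_(e <- divisors m)
    (p ^ k.+1 * m %/ (p ^ k.+1 * e))%N%:Z ^+ a * rho a (p ^ k.+1 * e)
    = 1 - p%:Z ^+ a.
  rewrite -[RHS]mulr1 -[X in _ = _ * X]IHm big_distrr /= !big_seq; apply: eq_bigr => e.
  rewrite -dvdn_divisors // => e_m.
  have pNe : ~~ (p %| e)%N by apply: contra pNm => /dvdn_trans; apply.
  by rewrite divnMl ?pX_gt0 // rho_primepow_mul ?(dvdn_gt0 m_gt0) // mulrCA.
by rewrite addrC subrK.
Qed.

Lemma diag_entryE a m : (0 < m)%N -> diag_entry a m = m%:Z ^+ a * rho a m.
Proof.
move=> m_gt0; rewrite {2}(prod_prime_decomp m_gt0) prime_decompE big_map /=.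
rewrite -natz natr_prod -prodrXl -big_split; apply: eq_bigr => p _ /=.
by rewrite natrX natz mulrBr mulr1 -!exprM -exprD addnC -mulSn ![(a * _)%N]mulnC.
Qed.

(** Factor closedness makes each divisor of [m] some [x k], and injectivity makes that [k] unique.
    Allowing any [m] below some [x i] covers both an element of the set and a gcd. *)
Lemma sum_divisors_closed (n : nat) (x : 'I_n -> nat) (F : nat -> int)
    (x_gt0 : forall i, (0 < x i)%N) (x_inj : injective x)
    (x_closed : factor_closed [pred m | m \in codom x])
    (i : 'I_n) (m : nat) : (m %| x i)%N ->
  \sum_(k | (x k %| m)%N) F (x k) = \sum_(d <- divisors m) F d.
Proof.
move=> m_xi; have m_gt0 := dvdn_gt0 (x_gt0 i) m_xi.
rewrite -big_filter -(big_map x xpredT); apply: perm_big; apply: uniq_perm.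
- by rewrite map_inj_uniq // filter_uniq // index_enum_uniq.
- exact: divisors_uniq.
move=> d; rewrite -dvdn_divisors //; apply/mapP/idP => [[k]|d_m].
  by rewrite mem_filter => /andP[? _] ->.
have d_gt0 := dvdn_gt0 m_gt0 d_m.
have /codomP[k def_d] : d \in codom x.
  apply: (x_closed (x i)) => //; first exact: codom_f.
  exact: dvdn_trans m_xi.
by exists k => //; rewrite mem_filter -def_d d_m mem_index_enum.
Qed.

Lemma sum_divisors_multiples (F : nat -> int) c m :
  (0 < m)%N -> (c %| m)%N ->
  \sum_(d <- divisors m | (c %| d)%N) F d =
  \sum_(e <- divisors (m %/ c)) F (c * e)%N.
Proof.
move=> m_gt0 c_m; have c_gt0 := dvdn_gt0 m_gt0 c_m.
have q_gt0 : (0 < m %/ c)%N by rewrite divn_gt0 // dvdn_leq.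
rewrite -big_filter -(big_map (muln c) xpredT); apply: perm_big.
apply: uniq_perm; first by rewrite filter_uniq // divisors_uniq.
  rewrite map_inj_uniq ?divisors_uniq // => e f /eqP.
  by rewrite eqn_pmul2l // => /eqP.
move=> d; rewrite mem_filter -dvdn_divisors //.
apply/andP/mapP => [[c_d d_m]|[e]].
  exists (d %/ c)%N; last by rewrite mulnC divnK.
  by rewrite -dvdn_divisors // dvdn_divRL // divnK.
rewrite -dvdn_divisors // dvdn_divRL // mulnC => e_m ->.
by rewrite dvdn_mulr.
Qed.

Definition C_matrix (a : nat) {n : nat} (x : 'I_n -> nat) : 'M[int]_n :=
  \matrix_(i, j) if (x i %| x j)%N then (x j %/ x i)%N%:Z ^+ a else 0.

Lemma mulmx_B_C (a n : nat) (x : 'I_n -> nat)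
    (x_gt0 : forall i, (0 < x i)%N) (x_inj : injective x)
    (x_closed : factor_closed [pred m | m \in codom x]) :
  B_matrix a x *m C_matrix a x = 1%:M.
Proof.
apply/matrixP => i j; rewrite !mxE.
have [xij|xNij] := boolP (x i %| x j)%N; last first.
  have /negPf -> : i != j by apply: contraNneq xNij => ->.
  rewrite big1 // => k _; rewrite !mxE.
  case: ifP => [ik|]; last by rewrite mul0r.
  case: ifP => [kj|]; last by rewrite mulr0.
  by rewrite (dvdn_trans ik kj) in xNij.
(* The weights of [B] and [C] multiply to [(x j / x i) ^ a] whatever [k] is, which leaves a pure
   Moebius sum. *)
transitivity ((x j %/ x i)%N%:Z ^+ a *
   \sum_(k | (x k %| x j)%N)
     (if (x i %| x k)%N then moebius (x k %/ x i) else 0)).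
  rewrite big_distrr /= [RHS]big_mkcond; apply: eq_bigr => k _; rewrite !mxE.
  case: (boolP (x k %| x j)%N) => [kj|]; last by rewrite mulr0.
  case: ifP => [ik|]; last by rewrite mul0r mulr0.
  rewrite -mulrA -exprMn -PoszM mulrC; congr (_ %:Z ^+ a * _).
  by rewrite mulnC muln_divA // divnK.
rewrite (@sum_divisors_closed n x
  (fun d => if (x i %| d)%N then moebius (d %/ x i) else 0)
  x_gt0 x_inj x_closed j) //.
rewrite -big_mkcond sum_divisors_multiples //.
under eq_bigr do rewrite mulKn //.
have q_gt0 : (0 < x j %/ x i)%N by rewrite divn_gt0 // dvdn_leq.
have -> : (i == j) = (x j %/ x i == 1)%N.
  by rewrite -[RHS](eqn_pmul2r (x_gt0 i)) divnK // mul1n eq_sym (inj_eq x_inj).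
rewrite (sum_moebius _ q_gt0); case: eqP => [->|_]; last by rewrite mulr0.
by rewrite expr1n mulr1.
Qed.

Lemma lcm_power_matrix_factor (a n : nat) (x : 'I_n -> nat)
    (x_gt0 : forall i, (0 < x i)%N) (x_inj : injective x)
    (x_closed : factor_closed [pred m | m \in codom x]) :
  lcm_power_matrix a x =
  (C_matrix a x)^T *m diag_mx (\row_i diag_entry a (x i)) *m C_matrix a x.
Proof.
apply/matrixP => i j; rewrite !mxE.
set g := gcdn (x i) (x j).
have g_gt0 : (0 < g)%N by rewrite gcdn_gt0 x_gt0.
(* The factor 1 is expanded as a sum over the divisors of the gcd, which are exactly the [x k]
   dividing both [x i] and [x j]. *)
rewrite -[LHS]mulr1 -(sum_rho a g) //.
rewrite -(@sum_divisors_closed n x _ x_gt0 x_inj x_closed i) ?dvdn_gcdl //.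
rewrite big_distrr [LHS]big_mkcond; apply: eq_bigr => k _ /=.
rewrite mul_mx_diag !mxE dvdn_gcd.
case: ifP => /andP; last first.
  move=> kN; case: ifP => ki; last by rewrite !mul0r.
  by case: ifP => kj; rewrite ?mulr0 //; case: kN.
case=> ki kj; rewrite ki kj diag_entryE // mulrA.
have -> u v w r : u * (v * r) * w = (u * v * w) * r :> int by ring.
(* Both bases equal [x i * x j / x k], because lcm times gcd is the product. *)
congr (_ * _); rewrite -!exprMn -!PoszM divnK //; congr (_ %:Z ^+ a).
have k_g : (x k %| g)%N by rewrite dvdn_gcd ki.
by rewrite !muln_divA // muln_lcm_gcd.
Qed.

Theorem theorem1p2 (a n : nat) (a_gt0 : (0 < a)%N) (n_gt0 : (0 < n)%N)
    (x : 'I_n -> nat) (x_gt0 : forall i : 'I_n, (0 < x i)%N)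
    (x_inj : injective x)
    (x_closed : factor_closed [pred m | m \in codom x])
    (x_first : x (Ordinal n_gt0) = 1%N) :
  (B_matrix a x)^T *m lcm_power_matrix a x *m B_matrix a x =
  diag_mx (\row_(i < n)
    if i == Ordinal n_gt0 then 1 else diag_entry a (x i)).
Proof.
(* A one-sided inverse of a square matrix over a commutative ring is two-sided; the cancellations
   below need this order of the product. *)
have CB : C_matrix a x *m B_matrix a x = 1%:M.
  by apply: mulmx1C; apply: mulmx_B_C.
rewrite lcm_power_matrix_factor // !mulmxA -trmx_mul CB trmx1 mul1mx.
rewrite -mulmxA CB mulmx1; congr diag_mx; apply/rowP => i; rewrite !mxE.
(* The leading 1 is the empty product over the primes of [x_1 = 1]. *)
by case: eqP => // ->; rewrite x_first /diag_entry big_nil.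
Qed.
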